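(* Let $g$ be a Carmichael polynomial in $\mathbb{F}_q[t]$. Then $g$ is Carmichael in every finite Galois extension $K$ of $\mathbb{F}_q(t)$ whose discriminant is relatively prime to $g$.
   Context: $\mathbb{F}_q$ is the finite field with $q$ elements. A finite ring $S$ is a Carmichael ring if $S$ is not a field and $a^{|S|}=a$ for every $a\in S$; an ideal $I$ of a ring $R$ is a Carmichael ideal if $R/I$ is a Carmichael ring. A polynomial $g\in\mathbb{F}_q[t]$ is a Carmichael polynomial if $(g)$ is a Carmichael ideal of $\mathbb{F}_q[t]$. For a finite extension $K$ of $\mathbb{F}_q(t)$, $\mathcal{O}_K$ denotes the integral closure of $\mathbb{F}_q[t]$ in $K$, and an element $\alpha\in\mathcal{O}_K$ is Carmichael in $K$ if $\alpha\mathcal{O}_K$ is a Carmichael ideal of $\mathcal{O}_K$. The discriminant of $K$ is the discriminant ideal of $\mathcal{O}_K$ over $\mathbb{F}_q[t]$; ''relatively prime to $g$'' means no irreducible factor of $g$ divides it. *)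

(* Defs.v *)
From HB Require Import structures.
From mathcomp Require Import all_boot all_order all_algebra all_field.
Set Implicit Arguments. Unset Strict Implicit. Unset Printing Implicit Defensive.
Import GRing.Theory.
Local Open Scope ring_scope.

(* Quotients R/I of a commutative ring R, where R is given as a subring
   (predicate Rp) of an ambient commutative ring A, and I is an ideal of R
   (predicate I).  We do not build the quotient type; elements of R/I are
   represented by elements of R, two being equal in R/I iff their difference
   lies in I.                                                              *)

Section QuotientRing.
Variable A : comNzRingType.
Variables (Rp I : A -> Prop).

Definition qcong (x y : A) : Prop := I (x - y).

(* s is a complete, irredundant system of representatives of R/I;
   hence R/I is finite and |R/I| = size s. *)
Definition qreps (s : seq A) : Prop :=
  [/\ forall x, x \in s -> Rp x,
      (forall i j, (i < size s)%N -> (j < size s)%N ->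
         qcong (nth 0 s i) (nth 0 s j) -> i = j)
    & forall x, Rp x -> exists2 y, y \in s & qcong x y].

Definition quotient_is_field : Prop :=
  ~ qcong 1 0 /\
  forall x, Rp x -> ~ qcong x 0 -> exists2 y, Rp y & qcong (x * y) 1.

Definition Carmichael_ideal : Prop :=
  exists s, [/\ qreps s, ~ quotient_is_field
              & forall a, Rp a -> qcong (a ^+ size s) a].
End QuotientRing.

Definition Carmichael_poly (Fq : finFieldType) (g : {poly Fq}) : Prop :=
  Carmichael_ideal (fun _ : {poly Fq} => True) (fun x => is_true (g %| x)%R).

Section FunctionField.
Variable Fq : finFieldType.
Local Notation Fqt := {fraction {poly Fq}}.
Variable L : fieldExtType Fqt.

Definition polyK (p : {poly Fq}) : L := (FracField.tofrac p)%:A.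

Definition OK (x : L) : Prop :=
  exists2 p : {poly {poly Fq}}, p \is monic & root (map_poly polyK p) x.

Definition principalOK (alpha : L) (x : L) : Prop :=
  exists2 y, OK y & x = alpha * y.

Definition Carmichael_in (alpha : L) : Prop :=
  OK alpha /\ Carmichael_ideal OK (principalOK alpha).

Definition ftrace (a : L) : Fqt :=
  \tr (passmx.mxof (vbasis {:L}) (vbasis {:L}) (amull a)).

Definition fdisc (b : (\dim {:L}).-tuple L) : Fqt :=
  \det (\matrix_(i < \dim {:L}, j < \dim {:L}) ftrace (b`_i * b`_j)).

(* p divides the discriminant ideal of O_K over F_q[t], the ideal generated
   by the discriminants of all F_q(t)-bases of K contained in O_K. *)
Definition divides_disc (p : {poly Fq}) : Prop :=
  forall b : (\dim {:L}).-tuple L, basis_of {:L} b -> (forall i, OK b`_i) ->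
    exists2 h : {poly Fq}, (p %| h)%R & fdisc b = FracField.tofrac h.

Definition disc_coprime (g : {poly Fq}) : Prop :=
  forall p : {poly Fq}, irreducible_poly p -> (p %| g)%R -> ~ divides_disc p.
End FunctionField.

(* Main.v *)
(* Fix an irreducible factor p of g, let sigma_1, ..., sigma_n be the Galois
   automorphisms, and pick a basis b of K in O_K whose discriminant D is prime
   to p.  Since D is the square of det (sigma_j(b_i)), that matrix is invertible
   modulo p.  Hence b is a basis of O_K / p over F_q[t] / p, so |O_K / g| = N^n
   where N = |F_q[t] / g|.  Moreover the F_q[t]-linear map x |-> x^N on O_K / p
   is a combination sum_j c_j sigma_j; it is multiplicative, so independence of
   the sigma_j yields c_j (x^N - sigma_j(x)) = 0, and iterating n times,
   c_j (x^(N^n) - x) = 0.  As sum_j c_j = 1, we get x^(N^n) = x modulo p, hence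
   modulo the squarefree polynomial g.  Finally, if O_K / g were a field, then
   x (x^(N-1) - 1) = 0 would make F_q[t] / g a field too. *)
Require Import Defs.
From HB Require Import structures.
From Stdlib Require Import Classical.
From mathcomp Require Import fingroup cyclic.
From mathcomp Require Import all_boot all_order all_algebra all_field.
Set Implicit Arguments.
Unset Strict Implicit.
Unset Printing Implicit Defensive.
Import GRing.Theory.
Local Open Scope ring_scope.

(** * Divisibility in F[t] and integrality in its fraction field *)

Lemma irreducible_factor (F : fieldType) (f : {poly F}) :
  (1 < size f)%N -> exists2 p, irreducible_poly p & p %| f.
Proof.
have [k] := ubnP (size f); elim: k f => // k IHk f lt_fk f_gt1.
have [irr_f | red_f] := classic (irreducible_poly f); first by exists f.
have f0 : f != 0 by rewrite -size_poly_gt0 ltnW.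
have [q q_bad] : exists q : {poly F}, ~ (size q != 1%N -> q %| f -> q %= f).
  by apply: not_all_ex_not => all_q; apply: red_f.
have [q1 q_f_neq] := imply_to_and _ _ q_bad.
have [q_f q_neq_f] := imply_to_and _ _ q_f_neq.
have q0 : q != 0 by apply: contraNneq f0 => q0; move: q_f; rewrite q0 dvd0p.
have lt_qf : (size q < size f)%N.
  rewrite ltn_neqAle dvdp_leq // andbT; apply/negP => /eqP eq_qf.
  by apply: q_neq_f; rewrite -dvdp_size_eqp // eq_qf.
have q_gt1 : (1 < size q)%N by rewrite ltn_neqAle eq_sym q1 size_poly_gt0.
have [p irr_p p_q] := IHk q (leq_trans lt_qf lt_fk) q_gt1.
by exists p => //; apply: dvdp_trans p_q q_f.
Qed.

Lemma fraction_quotient (R : idomainType) (x : {fraction R}) :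
  exists a b : R, b != 0 /\ x = FracField.tofrac a / FracField.tofrac b.
Proof.
exists (frac (repr x)).1, (frac (repr x)).2; split; first exact: denom_ratioP.
apply/(canRL (mulfK _)); first by rewrite tofrac_eq0 denom_ratioP.
rewrite -{1}[x]reprK; move: (repr x) => r.
unlock FracField.tofrac; rewrite -[LHS]FracField.pi_mul; apply/eqmodP => /=.
rewrite FracField.equivfE /FracField.mulf.
rewrite !numden_Ratio ?mulf_neq0 ?oner_eq0 ?denom_ratioP //.
by rewrite !mulr1 mulrC.
Qed.

(** The rational root argument, with x = a/b in lowest terms: clearing denominators in a monic
    equation of degree k gives b | a^k, so b is a unit. *)
Lemma tofrac_integral (F : fieldType) (x : {fraction {poly F}}) :
  integralOver (@FracField.tofrac {poly F}) x ->
  exists c, x = FracField.tofrac c.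
Proof.
have [a [b [b0 cop_ba ->]]] : exists a b : {poly F},
    [/\ b != 0, coprimep b a & x = FracField.tofrac a / FracField.tofrac b].
  have [a [b [b0 ->]]] := fraction_quotient x; pose d := gcdp a b.
  have d0 : d != 0 by rewrite gcdp_eq0 negb_and b0 orbT.
  exists (a %/ d), (b %/ d); split.
  - by rewrite dvdp_div_eq0 // dvdp_gcdr.
  - by rewrite coprimep_sym coprimep_div_gcd // b0 orbT.
  - have defa : a = a %/ d * d by rewrite divpK ?dvdp_gcdl.
    have defb : b = b %/ d * d by rewrite divpK ?dvdp_gcdr.
    rewrite [in LHS]defa [in LHS]defb !rmorphM /=.
    by rewrite -mulf_div divff ?mulr1 // tofrac_eq0.
case=> p p_monic; rewrite /root horner_coef.
rewrite size_map_inj_poly ?rmorph0 //; last first.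
  by move=> u v /eqP; rewrite tofrac_eq => /eqP.
have p_gt0 : (0 < size p)%N by rewrite size_poly_gt0 monic_neq0.
rewrite -(prednK p_gt0); set k := (size p).-1.
rewrite big_ord_recr /= coef_map /= -lead_coefE (monicP p_monic) rmorph1 mul1r.
rewrite addr_eq0 => /eqP eq_sum.
have bF0 : FracField.tofrac b != 0 by rewrite tofrac_eq0.
have b_dvd : b %| a ^+ k.
  have -> : a ^+ k = - \sum_(i < k) p`_i * a ^+ i * b ^+ (k - i).
    apply/eqP; rewrite -tofrac_eq rmorphN rmorph_sum /= rmorphXn /=; apply/eqP.
    rewrite -[LHS](divfK (expf_neq0 k bF0)) -expr_div_n.
    rewrite -[X in X * _]opprK -eq_sum.
    rewrite mulNr mulr_suml; congr (- _); apply: eq_bigr => i _.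
    rewrite coef_map !rmorphM !rmorphXn /= expr_div_n -!mulrA.
    congr (_ * (_ * _)).
    by rewrite expfB // mulrC.
  rewrite dvdpNr; apply: (big_ind (fun u => b %| u)) => [|u v|i _].
  - exact: dvdp0.
  - exact: dvdp_add.
  by apply: dvdp_mull; rewrite -[(k - i)%N]prednK ?subn_gt0 // exprS dvdp_mulr.
have /size_poly1P[c c0 ->] : size b == 1%N.
  by rewrite -coprimepp; apply: coprimep_dvdl b_dvd _; apply: coprimep_expr.
exists (c^-1 *: a); apply/(canLR (mulfK _)).
  by rewrite tofrac_eq0 polyC_eq0.
by rewrite -rmorphM /= -scalerAl mulrC mul_polyC scalerA mulVf // scale1r.
Qed.

HB.instance Definition _ (Fq : finFieldType)
    (L : fieldExtType {fraction {poly Fq}}) :=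
  GRing.RMorphism.copy (@polyK Fq L) (in_alg L \o @FracField.tofrac {poly Fq}).

(** * The ring O_K and its ideals generated by polynomials *)

Section IntegersOfL.

Variables (Fq : finFieldType) (L : fieldExtType {fraction {poly Fq}}).
Implicit Types (x y z : L) (f h p : {poly Fq}).

Lemma polyK_inj : injective (polyK L).
Proof.
move=> f h /(fmorph_inj (in_alg L)) /eqP.
by rewrite tofrac_eq => /eqP.
Qed.

Lemma polyK_eq0 f : (polyK L f == 0) = (f == 0).
Proof. by rewrite -(rmorph0 (polyK L)) (inj_eq polyK_inj). Qed.

Lemma OK_polyK f : OK (polyK L f). Proof. exact: integral_id. Qed.
Lemma OK0 : OK (0 : L). Proof. exact: integral0. Qed.
Lemma OK1 : OK (1 : L). Proof. exact: integral1. Qed.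
Lemma OKD x y : OK x -> OK y -> OK (x + y). Proof. exact: integral_add. Qed.
Lemma OKB x y : OK x -> OK y -> OK (x - y). Proof. exact: integral_sub. Qed.
Lemma OKM x y : OK x -> OK y -> OK (x * y). Proof. exact: integral_mul. Qed.

Lemma OKX x k : OK x -> OK (x ^+ k).
Proof.
by move=> Ox; elim: k => [|k IHk]; [apply: OK1 | rewrite exprS; apply: OKM].
Qed.

Lemma OK_sum (I : Type) (r : seq I) (P : pred I) (E : I -> L) :
  (forall i, P i -> OK (E i)) -> OK (\sum_(i <- r | P i) E i).
Proof. by move=> OE; apply: big_ind => //; [apply: OK0 | apply: OKD]. Qed.

Lemma OK_prod (I : Type) (r : seq I) (P : pred I) (E : I -> L) :
  (forall i, P i -> OK (E i)) -> OK (\prod_(i <- r | P i) E i).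
Proof. by move=> OE; apply: big_ind => //; [apply: OK1 | apply: OKM]. Qed.

Lemma OK_det k (M : 'M[L]_k) : (forall i j, OK (M i j)) -> OK (\det M).
Proof.
move=> OM; apply: OK_sum => s _; apply: OKM; last by apply: OK_prod.
by rewrite -(rmorph_sign (polyK L)); apply: OK_polyK.
Qed.

Lemma OK_adj k (M : 'M[L]_k) i j :
  (forall i j, OK (M i j)) -> OK (\adj M i j).
Proof.
move=> OM; rewrite mxE; apply: OKM; last by apply: OK_det => ? ?; rewrite !mxE.
by rewrite -(rmorph_sign (polyK L)); apply: OK_polyK.
Qed.

(** The monic equation already holds in F_q(t), embedded in L as [1%VS], and F_q[t] is integrally
    closed. *)
Lemma OK_rational x : OK x -> x \in 1%VS -> exists c, x = polyK L c.
Proof.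
move=> [p p_monic px0] /vlineP[u def_x]; rewrite def_x in px0 *.
have [|c ->] := @tofrac_integral _ u; last by exists c.
exists p => //; move: px0; rewrite (map_poly_comp (in_alg L)) /=.
by rewrite (fmorph_root (in_alg L)).
Qed.

Local Notation I f := (principalOK (polyK L f)).

Lemma principalOK0 f : I f 0.
Proof. by exists 0; [apply: OK0 | rewrite mulr0]. Qed.

Lemma principalOKD f x y : I f x -> I f y -> I f (x + y).
Proof.
by move=> [u Ou ->] [v Ov ->]; exists (u + v); [apply: OKD | rewrite mulrDr].
Qed.

Lemma principalOKMr f x y : I f x -> OK y -> I f (x * y).
Proof.
by move=> [u Ou ->] Oy; exists (u * y); [apply: OKM | rewrite mulrA].
Qed.

Lemma principalOKMl f x y : OK x -> I f y -> I f (x * y).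
Proof. by move=> Ox fy; rewrite mulrC; apply: principalOKMr. Qed.

Lemma principalOKN f x : I f x -> I f (- x).
Proof.
move=> [u Ou ->]; exists (0 - u); last by rewrite sub0r mulrN.
by apply: OKB => //; apply: OK0.
Qed.

Lemma principalOKB f x y : I f x -> I f y -> I f (x - y).
Proof. by move=> fx fy; apply: principalOKD => //; apply: principalOKN. Qed.

Lemma principalOK_sum f (T : Type) (r : seq T) (P : pred T) (E : T -> L) :
  (forall i, P i -> I f (E i)) -> I f (\sum_(i <- r | P i) E i).
Proof.
by move=> fE; apply: big_ind => //; [apply: principalOK0 | apply: principalOKD].
Qed.

Lemma principalOK_dvdp f h : f %| h -> I f (polyK L h).
Proof.
by move=> /dvdpP[c ->]; rewrite rmorphM mulrC; exists (polyK L c);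
  first exact: OK_polyK.
Qed.

(** The quotient h/f is both integral and rational, hence a polynomial. *)
Lemma principalOK_polyK f h : f != 0 -> I f (polyK L h) -> f %| h.
Proof.
move=> f0 [y Oy def_h].
have f0L : polyK L f != 0 by rewrite polyK_eq0.
have [|c def_y] := OK_rational Oy.
  have -> : y = polyK L h / polyK L f by rewrite def_h mulrC mulKf.
  rewrite -[1%VS]/(1%AS : {vspace L}) rpred_div // /polyK memvZ ?mem1v //.
by apply/dvdpP; exists c; apply: polyK_inj; rewrite rmorphM def_h def_y mulrC.
Qed.

Lemma coprime_inverse_mod f h : coprimep f h ->
  exists u, I f (polyK L (u * h) - 1).
Proof.
move=> /Bezout_eq1_coprimepP[[u v] /= uv1]; exists v.
rewrite -(rmorph1 (polyK L)) -rmorphB; apply: principalOK_dvdp.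
by rewrite -uv1 opprD addrCA subrr addr0 dvdpNr dvdp_mull.
Qed.

(** With u an inverse of h modulo f, x = u(hx) - (uh - 1)x. *)
Lemma principalOK_coprime_cancel f h x :
  coprimep f h -> OK x -> I f (polyK L h * x) -> I f x.
Proof.
move=> /coprime_inverse_mod[u hu] Ox fhx.
have -> : x = polyK L u * (polyK L h * x) - (polyK L (u * h) - 1) * x.
  by rewrite mulrBl mul1r mulrA -rmorphM opprB addrCA subrr addr0.
apply: principalOKB; first by apply: principalOKMl => //; apply: OK_polyK.
exact: principalOKMr.
Qed.

(** Writing x = hy, cancellation of h modulo f puts y in the ideal of f. *)
Lemma principalOK_coprime_mul f h x :
  coprimep f h -> I f x -> I h x -> I (f * h) x.
Proof.
move=> cop_fh fx [y Oy def_x]; rewrite def_x in fx *.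
have [z Oz ->] := principalOK_coprime_cancel cop_fh Oy fx.
by exists z; rewrite // rmorphM mulrCA mulrA.
Qed.

End IntegersOfL.

(** * Galois conjugates, traces and discriminants *)

Section GaloisConjugates.

Variables (Fq : finFieldType) (L : splittingFieldType {fraction {poly Fq}}).
Hypothesis galL : galois 1%VS {:L}.
Local Notation n := (\dim {:L}).
Local Notation Gal1 := ('Gal({:L} / 1%VS))%g.
Local Notation I f := (principalOK (polyK L f)).
Implicit Types (w x : L) (b : n.-tuple L) (p : {poly Fq}).

Lemma card_gal1 : #|Gal1| = n.
Proof. by rewrite -(galois_dim galL) dimv1 divn1. Qed.

(** Numbering the Galois group by ['I_n] makes the matrix of conjugates of a basis square. *)
Definition conjugation (j : 'I_n) : gal_of {:L} :=
  enum_val (cast_ord (esym card_gal1) j).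

Lemma sum_conjugation (E : gal_of {:L} -> L) :
  \sum_(s in Gal1) E s = \sum_j E (conjugation j).
Proof.
rewrite big_enum_val /= (reindex (cast_ord (esym card_gal1))) //=.
by exists (cast_ord card_gal1) => j _; rewrite ?cast_ordK ?cast_ordKV.
Qed.

Lemma conjugation1 : exists j, conjugation j = 1%g.
Proof.
exists (cast_ord card_gal1 (enum_rank_in (group1 _) 1%g)).
by rewrite /conjugation cast_ordK enum_rankK_in.
Qed.

Lemma conjugation_polyK j f : conjugation j (polyK L f) = polyK L f.
Proof. by rewrite linearZ /= rmorph1. Qed.

Lemma OK_conjugation j w : OK w -> OK (conjugation j w).
Proof.
case=> q q_monic qw0; exists q => //.
have -> : map_poly (polyK L) q =
    map_poly (conjugation j) (map_poly (polyK L) q).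
  by apply/polyP => i; rewrite !coef_map /= conjugation_polyK.
by rewrite fmorph_root.
Qed.

Lemma conjugation_expn j w : (conjugation j ^+ n)%g w = w.
Proof.
by rewrite -card_gal1 expg_cardG ?gal_id //; apply: enum_valP.
Qed.

Lemma conjugationX j w k :
  (conjugation j ^+ k.+1)%g w = conjugation j ((conjugation j ^+ k)%g w).
Proof. by rewrite expgSr galM ?memvf. Qed.

Definition conjugate_mx b := \matrix_(i < n, j < n) conjugation j b`_i.

Lemma OK_conjugate_mx b : (forall i, OK b`_i) ->
  forall i j, OK (conjugate_mx b i j).
Proof. by move=> Ob i j; rewrite mxE; apply: OK_conjugation. Qed.

(* By Dedekind's independence of automorphisms. *)
Lemma conjugate_mx_unit b : basis_of {:L} b -> conjugate_mx b \in unitmx.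
Proof.
move=> basis_b; rewrite -unitmx_tr -row_free_unit; apply: inj_row_free => v v0.
pose c s := \sum_(j | conjugation j == s) v 0 j.
have conj_inj : injective conjugation by move=> i j /enum_val_inj/cast_ord_inj.
have cE j : c (conjugation j) = v 0 j.
  rewrite /c (eq_bigl (pred1 j)) ?big_pred1_eq // => i.
  by rewrite (inj_eq conj_inj).
have c0 s : s \in Gal1 -> c s = 0.
  move: s; apply: gal_independent => a _.
  rewrite (@sum_conjugation (fun s => c s * s a)).
  rewrite (coord_basis basis_b (memvf a)).
  under eq_bigr => j _ do rewrite cE linear_sum mulr_sumr.
  rewrite exchange_big big1 // => i _.
  have /rowP/(_ i) := v0; rewrite !mxE => vi0.
  transitivity (coord b i a *: (\sum_j v 0 j * (conjugate_mx b)^T j i)).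
    rewrite scaler_sumr; apply: eq_bigr => j _.
    by rewrite !mxE linearZ -scalerAr.
  by rewrite vi0 scaler0.
by apply/rowP => j; rewrite -cE c0 ?mxE //; apply: enum_valP.
Qed.

(** Applying each sigma_j to b_i w = sum_k M_ik b_k gives M B = B diag(sigma_j(w)), so M is similar
    to that diagonal matrix and has the same trace. *)
Lemma ftraceE w : (ftrace w)%:A = \sum_j conjugation j w.
Proof.
have basis_b := vbasisP {:L}.
set b := vbasis {:L} in basis_b *.
pose M := passmx.mxof b b (amull w).
pose B := conjugate_mx b.
pose d := \row_j conjugation j w.
have bw (i : 'I_n) : b`_i * w = \sum_(k < n) M i k *: b`_k.
  have := passmx.mul_mxof b b (amull w) (delta_mx 0 i).
  rewrite passmx.vecof_delta // -rowE => /(congr1 (passmx.vecof b)).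
  rewrite passmx.rVofK // lfunE /= mulrC => <-.
  by apply: eq_bigr => k _; rewrite mxE.
have MB : map_mx (in_alg L) M *m B = B *m diag_mx d.
  clearbody M; apply/matrixP => i j; rewrite mul_mx_diag !mxE -rmorphM /= bw.
  rewrite linear_sum; apply: eq_bigr => k _.
  by rewrite !mxE linearZ /= mulr_algl.
have /(congr1 mxtrace) : map_mx (in_alg L) M = B *m diag_mx d *m invmx B.
  by rewrite -MB mulmxK // conjugate_mx_unit.
rewrite trace_map_mx mxtrace_mulC mulKmx ?conjugate_mx_unit // mxtrace_diag.
move=> trM; rewrite -[LHS]/(in_alg L (\tr M)) trM.
by apply: eq_bigr => j _; rewrite mxE.
Qed.

(** The sum of the conjugates is integral and fixed by the Galois group, hence rational. *)
Lemma integral_trace w : OK w ->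
  exists c, polyK L c = \sum_j conjugation j w.
Proof.
move=> Ow; have [||c ->] := @OK_rational _ _ (\sum_j conjugation j w).
- by apply: OK_sum => j _; apply: OK_conjugation.
- rewrite -(@sum_conjugation (fun s => s w)).
  by apply: (mem_galTrace galL); apply: memvf.
by exists c.
Qed.

(** The trace form has Gram matrix B B^T on b, where B is the conjugate matrix. *)
Lemma fdiscE b : (fdisc b)%:A = \det (conjugate_mx b) ^+ 2.
Proof.
rewrite expr2 -{2}det_tr -det_mulmx /fdisc -[LHS]/(in_alg L _) -det_map_mx.
congr (\det _); apply/matrixP => i k; rewrite !mxE /= ftraceE.
by apply: eq_bigr => j _; rewrite !mxE rmorphM.
Qed.

Lemma integral_disc b : (forall i, OK b`_i) ->
  exists D, fdisc b = FracField.tofrac D.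
Proof.
move=> Ob; have [||D def_D] := @OK_rational _ _ (\det (conjugate_mx b) ^+ 2).
- by apply: OKX; apply: OK_det; apply: OK_conjugate_mx.
- by rewrite -fdiscE; apply: memvZ; apply: mem1v.
by exists D; apply: (fmorph_inj (in_alg L)); rewrite /= fdiscE def_D.
Qed.

(** By contradiction: without such a basis, p would divide the discriminant of every integral basis.
    As p is irreducible, not dividing D means being coprime to D. *)
Lemma unramified_basis p : irreducible_poly p -> ~ divides_disc L p ->
  exists b D, [/\ forall i, OK b`_i, D != 0,
    polyK L D = \det (conjugate_mx b) ^+ 2 & coprimep p D].
Proof.
move=> irr_p ndiv_p; apply: NNPP => no_b; apply: ndiv_p => b basis_b Ob.
have [D def_D] := integral_disc Ob.
exists D => //; apply/negPn/negP => ndiv_D.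
apply: no_b; exists b, D; split=> //.
- by apply: contraNneq ndiv_D => ->; rewrite dvdp0.
- by rewrite -fdiscE def_D.
- by rewrite irreducible_poly_coprime.
Qed.
End GaloisConjugates.

(** * Systems of representatives *)

Section ResidueSystems.

Variables (A : comNzRingType) (Rp I : A -> Prop).

(** Indexing by a finite type instead of a list lets cardinalities be read off products and matrix
    types. *)
Definition residue_system (T : finType) (E : T -> A) : Prop :=
  [/\ forall x, Rp (E x), forall x y, I (E x - E y) -> x = y
    & forall z, Rp z -> exists x, I (z - E x)].

Lemma qreps_residue_system (T : finType) (E : T -> A) :
  residue_system E -> qreps Rp I [seq E x | x <- enum T].
Proof.
case=> RE E_inj E_full; split=> [_ /mapP[x _ ->] // | i j | z Rz].
  rewrite size_map => lt_iT lt_jT; have x0 : T.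
    by case: (enum T) lt_iT => [|x ? _].
  rewrite /qcong (nth_map x0 0 E lt_iT) (nth_map x0 0 E lt_jT) => /E_inj /eqP.
  by rewrite nth_uniq ?enum_uniq // => /eqP.
have [x Ix] := E_full z Rz.
by exists (E x) => //; apply: map_f; rewrite mem_enum.
Qed.

End ResidueSystems.

(** * Residues and independence modulo an unramified prime *)

Section UnramifiedPrime.

Variables (Fq : finFieldType) (L : splittingFieldType {fraction {poly Fq}}).
Hypothesis galL : galois 1%VS {:L}.
Local Notation n := (\dim {:L}).
Local Notation I f := (principalOK (polyK L f)).
Local Notation conjugation := (conjugation galL).
Implicit Types (w x v : L).

Lemma integral_traces (T : finType) (E : T -> L) : (forall k, OK (E k)) ->
  exists c : T -> {poly Fq},
    forall k, polyK L (c k) = \sum_j conjugation j (E k).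
Proof.
move=> OE.
apply: (fin_all_exists
         (P := fun k ck => polyK L ck = \sum_j conjugation j (E k))).
by move=> k; apply: integral_trace.
Qed.

Variables (p D : {poly Fq}) (b : n.-tuple L).
Hypotheses (Ob : forall i, OK b`_i)
  (D0 : D != 0) (discD : polyK L D = \det (conjugate_mx galL b) ^+ 2)
  (coprime_pD : coprimep p D).
Local Notation B := (conjugate_mx galL b).

Let OB := OK_conjugate_mx galL Ob.

(** The traces C of the w b_k equal the coordinate row of w times T = B B^T, the trace matrix, of
    determinant D. By Cramer's rule, D times the coordinates is C adj(T), which is polynomial. *)
Lemma disc_span w : OK w -> exists a : 'I_n -> {poly Fq},
  polyK L D * w = \sum_(i < n) polyK L (a i) * b`_i.
Proof.
move=> Ow.
have [c cE] := @integral_traces 'I_n _ (fun k => OKM Ow (Ob k)).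
have [t tE] := @integral_traces ('I_n * 'I_n)%type _
  (fun ik => OKM (Ob ik.1) (Ob ik.2)).
pose T := \matrix_(i, k) t (i, k); pose C := \row_k c k.
pose W := \row_j conjugation j w.
have TE : map_mx (polyK L) T = B *m B^T.
  apply/matrixP => i k; rewrite !mxE tE; apply: eq_bigr => j _.
  by rewrite !mxE rmorphM.
have CE : map_mx (polyK L) C = W *m B^T.
  apply/matrixP => i k; rewrite !mxE cE; apply: eq_bigr => j _.
  by rewrite !mxE rmorphM.
have detBB : \det (B *m B^T) = polyK L D.
  by rewrite det_mulmx det_tr discD expr2.
have DL0 : polyK L D != 0 by rewrite polyK_eq0.
(* A right inverse of the square matrix B is also a left inverse; this moves B to the right of the
   adjugate. *)
have BX : (B^T *m \adj (B *m B^T)) *m B = (polyK L D)%:M.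
  have : B *m ((polyK L D)^-1 *: (B^T *m \adj (B *m B^T))) = 1%:M.
    rewrite -scalemxAr mulmxA mul_mx_adj detBB scale_scalar_mx mulVf //.
  move/mulmx1C; rewrite -scalemxAl => /(congr1 ( *:%R (polyK L D))).
  by rewrite scalerA divff // scale1r scalemx1.
exists (fun i => (C *m \adj T) 0 i).
have aB : map_mx (polyK L) (C *m \adj T) *m B = polyK L D *: W.
  rewrite map_mxM map_mx_adj TE CE -[_ *m \adj _]mulmxA -mulmxA BX.
  by rewrite mul_mx_scalar.
(* The column of the identity automorphism carries the claim about w itself. *)
have [j1 j1E] := conjugation1 galL.
have /rowP/(_ j1) := aB; rewrite !mxE j1E gal_id => <-.
by apply: eq_bigr => i _; rewrite !mxE j1E gal_id.
Qed.

(** Conjugating sum a_i b_i = p y gives A B = p Y; multiplying by adj(B) det(B) shows that p divides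
    D a_i in O_K, and D is prime to p. *)
Lemma basis_independent_mod (a : 'I_n -> {poly Fq}) : p != 0 ->
  I p (\sum_(i < n) polyK L (a i) * b`_i) -> forall i, p %| a i.
Proof.
move=> p0 [y Oy def_y] i.
rewrite -(Gauss_dvdpl _ coprime_pD); apply: (@principalOK_polyK _ L) => //.
pose A := \row_k polyK L (a k); pose Y := \row_j conjugation j y.
have AB : A *m B = polyK L p *: Y.
  apply/rowP => j; rewrite !mxE -[polyK L p](conjugation_polyK galL j).
  rewrite -rmorphM -def_y rmorph_sum.
  by apply: eq_bigr => k _; rewrite !mxE [RHS]rmorphM /= conjugation_polyK.
have : A *m B *m \adj B = polyK L p *: (Y *m \adj B) by rewrite AB scalemxAl.
rewrite -mulmxA mul_mx_adj mul_mx_scalar => /rowP/(_ i); rewrite !mxE => eq_i.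
rewrite rmorphM /= discD expr2 mulrA [polyK L (a i) * _]mulrC eq_i -mulrA.
exists ((\sum_j Y 0 j * \adj B j i) * \det B) => //.
apply: OKM; last exact: OK_det.
apply: OK_sum => j _; apply: OKM; first by rewrite mxE; apply: OK_conjugation.
exact: OK_adj.
Qed.

(** Multiplying the system B d = 0 modulo p by det(B) adj(B) gives D d = 0, and D cancels. *)
Lemma conjugations_independent_mod (d : 'I_n -> L) : (forall j, OK (d j)) ->
  (forall i : 'I_n, I p (\sum_j d j * conjugation j b`_i)) ->
  forall j, I p (d j).
Proof.
move=> Od pd j; apply: (principalOK_coprime_cancel coprime_pD (Od j)).
have -> : polyK L D * d j =
    \sum_i \det B * \adj B j i * (\sum_k d k * conjugation k b`_i).
  pose dc := \col_k d k.
  have /colP/(_ j) : \adj B *m (B *m dc) = \det B *: dc.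
    by rewrite mulmxA mul_adj_mx mul_scalar_mx.
  rewrite !mxE discD expr2 -mulrA => <-; rewrite mulr_sumr.
  apply: eq_bigr => i _; rewrite !mxE mulrA; congr (_ * _ * _).
  by apply: eq_bigr => k _; rewrite !mxE mulrC.
apply: principalOK_sum => i _; apply: principalOKMl (pd i).
by apply: OKM; [apply: OK_det OB | apply: OK_adj OB].
Qed.

(** * The power map x |-> x^N modulo p *)

Section Frobenius.

Variable N : nat.
Hypotheses (charN : [pchar L].-nat N) (powN : forall a, p %| a ^+ N - a).

(** [charN] makes x |-> x^N additive and [powN] makes it F_q[t]-linear modulo p, so agreement on the
    b_i with a combination of conjugations extends to O_K. *)
Lemma frobenius_decomposition : exists c : 'I_n -> L,
  [/\ forall j, OK (c j), I p (1 - \sum_j c j)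
    & forall j v, OK v -> I p (c j * (v ^+ N - conjugation j v))].
Proof.
have N_gt0 : (0 < N)%N by case/andP: charN.
have [u uD] := coprime_inverse_mod L coprime_pD.
(* These solve sum_j c_j sigma_j(b_i) = b_i^N modulo p: u inverts D = det(B)^2 modulo p, so u det(B)
   adj(B) acts as the inverse of B. *)
pose c j := polyK L u * \det B * \sum_(i < n) \adj B j i * b`_i ^+ N.
have Oc j : OK (c j).
  apply: OKM; first by apply: OKM; [apply: OK_polyK | apply: OK_det].
  apply: OK_sum => i _; apply: OKM; first exact: OK_adj OB.
  exact: OKX (Ob i).
have Bc (i : 'I_n) :
    \sum_j c j * conjugation j b`_i = polyK L (u * D) * b`_i ^+ N.
  pose bN : 'cV[L]_n := \col_k b`_k ^+ N.
  have /colP/(_ i) : B *m ((polyK L u * \det B) *: (\adj B *m bN)) =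
      polyK L (u * D) *: bN.
    rewrite -scalemxAr mulmxA mul_mx_adj mul_scalar_mx scalerA.
    by rewrite rmorphM /= discD expr2 mulrA.
  rewrite !mxE => <-; apply: eq_bigr => j _; rewrite !mxE mulrC.
  congr (_ * (_ * _)).
  by apply: eq_bigr => k _; rewrite !mxE.
(* [E] measures the failure of the decomposition; it is shown to vanish modulo p on O_K. *)
pose E v := v ^+ N - \sum_j c j * conjugation j v.
have OE v : OK v -> OK (E v).
  move=> Ov; apply: OKB; first exact: OKX.
  by apply: OK_sum => j _; apply: (OKM (Oc j)); apply: OK_conjugation.
have E_sum (F : 'I_n -> L) : E (\sum_i F i) = \sum_i E (F i).
  have powD : {morph (fun v : L => v ^+ N) : x y / x + y}.
    by move=> x y; apply: exprDn_pchar.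
  rewrite /E (big_morph _ powD (id1 := 0)) ?expr0n ?eqn0Ngt ?N_gt0 //.
  rewrite sumrB; congr (_ - _); rewrite exchange_big; apply: eq_bigr => j _.
  by rewrite raddf_sum mulr_sumr.
have E_scale a v : E (polyK L a * v) =
    polyK L (a ^+ N - a) * v ^+ N + polyK L a * E v.
  rewrite /E mulrBr mulr_sumr exprMn rmorphB rmorphXn /= mulrBl addrA subrK.
  congr (_ - _); apply: eq_bigr => j _.
  by rewrite rmorphM /= conjugation_polyK mulrCA.
(* Only D v is known to be a polynomial combination of the b_i, so the claim is proved for D v and D
   is cancelled. *)
have pE v : OK v -> I p (E v).
  move=> Ov; apply: (principalOK_coprime_cancel coprime_pD (OE v Ov)).
  have p_pow a x : OK x -> I p (polyK L (a ^+ N - a) * x ^+ N).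
    by move=> Ox; apply: principalOKMr (OKX N Ox); apply: principalOK_dvdp.
  have -> : polyK L D * E v =
      E (polyK L D * v) - polyK L (D ^+ N - D) * v ^+ N.
    by rewrite E_scale addrC addrA addNr add0r.
  apply: principalOKB; last exact: p_pow.
  have [a ->] := disc_span Ov; rewrite E_sum; apply: principalOK_sum => i _.
  rewrite E_scale; apply: principalOKD; first exact: p_pow.
  apply: principalOKMl; first exact: OK_polyK.
  have -> : E b`_i = - ((polyK L (u * D) - 1) * b`_i ^+ N).
    by rewrite /E Bc mulrBl mul1r opprB.
  by apply: principalOKN; apply: principalOKMr (OKX _ (Ob i)).
(* At v = 1 the vanishing of [E] says that the c_j sum to 1 modulo p. *)
exists c; split=> // [|j v Ov].
  have := pE 1 (@OK1 _ L); rewrite /E expr1n.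
  by under eq_bigr => j _ do rewrite rmorph1 mulr1.
apply: (@conjugations_independent_mod
         (fun j => c j * (v ^+ N - conjugation j v))) => {j} [j|i].
  by apply: (OKM (Oc j)); apply: OKB; [apply: OKX | apply: OK_conjugation].
(* Both the power map and the automorphisms are multiplicative, so the terms v^N b_i^N cancel in
   this difference. *)
have -> : \sum_j c j * (v ^+ N - conjugation j v) * conjugation j b`_i =
    E (v * b`_i) - v ^+ N * E b`_i.
  rewrite /E exprMn mulrBr opprB addrC addrA subrK mulr_sumr -sumrB.
  apply: eq_bigr => j _; rewrite rmorphM /= mulrBr mulrBl; congr (_ - _).
    by rewrite mulrCA mulrA.
  by rewrite -mulrA.
apply: principalOKB; first by apply/pE/OKM/Ob.
by apply: principalOKMl; [apply: OKX | apply/pE/Ob].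
Qed.

Lemma frobenius_iter_mod w : OK w -> I p (w ^+ (N ^ n) - w).
Proof.
move=> Ow; have [c [Oc c1 cN]] := frobenius_decomposition.
have Oconj j k : OK ((conjugation j ^+ k)%g w).
  elim: k => [|k IHk]; first by rewrite expg0 gal_id.
  by rewrite conjugationX; apply: OK_conjugation.
have ck j k : I p (c j * (w ^+ (N ^ k) - (conjugation j ^+ k)%g w)).
  elim: k => [|k IHk].
    by rewrite expn0 expr1 expg0 gal_id subrr mulr0; apply: principalOK0.
  set x := w ^+ _ in IHk; set y := (conjugation j ^+ k)%g w in IHk.
  have Oy : OK y by apply: Oconj.
  have Ox : OK x by apply: OKX.
  rewrite expnSr exprM -/x conjugationX -/y.
  (* The first term is a multiple of c_j (x - y), covered by the induction hypothesis; the second is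
     the decomposition at y. *)
  have -> : c j * (x ^+ N - conjugation j y) =
      c j * (x ^+ N - y ^+ N) + c j * (y ^+ N - conjugation j y).
    by rewrite -mulrDr addrA subrK.
  apply: principalOKD; last exact: cN.
  rewrite subrXX mulrA; apply: principalOKMr => //.
  by apply: OK_sum => i _; apply: OKM; apply: OKX.
set x := _ - w; have Ox : OK x by apply: OKB => //; apply: OKX.
have -> : x = (1 - \sum_j c j) * x + \sum_j c j * x.
  by rewrite mulrBl mul1r mulr_suml subrK.
apply: principalOKD; first exact: principalOKMr.
apply: principalOK_sum => j _.
(* The n-th power of an automorphism is trivial, since n is the order of the Galois group. *)
by have := ck j n; rewrite conjugation_expn.
Qed.

End Frobenius.

(** Representatives are the sums of a_i b_i with deg a_i < deg p, row i of the matrix holding the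
    coefficients of a_i. Independence modulo p separates them; every class is reached since the b_i
    span D w and D is invertible modulo p. *)
Lemma residue_system_unramified : p != 0 ->
  exists E : 'M[Fq]_(n, (size p).-1) -> L, residue_system (@OK _ L) (I p) E.
Proof.
move=> p0.
exists (fun M => \sum_(i < n) polyK L (rVpoly (row i M)) * b`_i); split.
- by move=> M; apply: OK_sum => i _; apply: OKM (OK_polyK _ _) (Ob i).
- move=> M M'; rewrite -sumrB => pM; apply/row_matrixP => i.
  apply: (can_inj rVpolyK); apply/eqP; rewrite -subr_eq0.
  apply/negPn/negP => neq0.
  have /(dvdp_leq neq0) : p %| rVpoly (row i M) - rVpoly (row i M').
    apply: (@basis_independent_mod
             (fun i => rVpoly (row i M) - rVpoly (row i M'))) => //.
    by under eq_bigr => k _ do rewrite rmorphB mulrBl.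
  (* The difference has size at most [(size p).-1], the degree of p, so a nonzero one cannot be
     divisible by p. *)
  rewrite leqNgt => /negP[]; apply: (@leq_ltn_trans (size p).-1); last first.
    by rewrite prednK ?size_poly_gt0.
  rewrite (leq_trans (size_polyD _ _)) // geq_max size_polyN.
  by rewrite !size_poly.
- move=> w Ow; have [u uD] := coprime_inverse_mod L coprime_pD.
  have [a aE] := disc_span Ow.
  exists (\matrix_(i < n) poly_rV ((u * a i) %% p)).
  have -> : w = polyK L u * (polyK L D * w) - (polyK L (u * D) - 1) * w.
    by rewrite mulrBl mul1r mulrA -rmorphM opprB addrCA subrr addr0.
  rewrite addrAC; apply: principalOKB; last exact: principalOKMr.
  rewrite aE mulr_sumr -sumrB; apply: principalOK_sum => i _.
  rewrite mulrA -mulrBl; apply: principalOKMr (Ob i).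
  rewrite rowK poly_rV_K; last first.
    by rewrite -ltnS prednK ?size_poly_gt0 // ltn_modp.
  rewrite -rmorphM -rmorphB; apply: principalOK_dvdp.
  by rewrite {1}(divp_eq (u * a i) p) addrK dvdp_mull.
Qed.

End UnramifiedPrime.

(** * Counting and powers in F_q[t] modulo g *)

Section PolynomialResidues.

Variable Fq : finFieldType.
Implicit Types (f g p : {poly Fq}).

(** Reduction modulo g matches the representatives with the polynomials of degree less than deg
    g. *)
Lemma size_qreps_poly g (s : seq {poly Fq}) : g != 0 ->
  qreps (fun _ => True) (fun x => is_true (g %| x)) s ->
  size s = (#|Fq| ^ (size g).-1)%N.
Proof.
move=> g0 [_ s_inj s_full]; pose d := (size g).-1.
have g_gt0 : (0 < size g)%N by rewrite size_poly_gt0.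
have modpP x y : (x %% g == y %% g) = (g %| x - y).
  by rewrite -subr_eq0 -modpN -modpD.
transitivity (size [seq rVpoly v | v <- enum 'rV[Fq]_d]); last first.
  by rewrite size_map -cardE card_mx mul1n.
rewrite -(size_map (fun x => x %% g)); apply/perm_size/uniq_perm.
- apply/(uniqP 0) => i j; rewrite !inE size_map => lt_is lt_js.
  by rewrite !(nth_map 0) // => /eqP; rewrite modpP; apply: s_inj.
- by rewrite map_inj_uniq ?enum_uniq //; apply: can_inj rVpolyK.
move=> y; apply/mapP/mapP => [[x _ ->] | [v _ ->]].
  exists (poly_rV (x %% g)); rewrite ?mem_enum // poly_rV_K //.
  by rewrite -ltnS prednK // ltn_modp.
have [x xs cong_x] := s_full (rVpoly v) Logic.I; exists x => //.
move: cong_x; rewrite /qcong -modpP modp_small => [/eqP //|].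
by rewrite -(prednK g_gt0) ltnS size_poly.
Qed.

(** If g were zero, the finite list would contain every polynomial, but X^k, with k the total of the
    sizes in the list, is larger than each entry. *)
Lemma qreps_poly_neq0 g (s : seq {poly Fq}) :
  qreps (fun _ => True) (fun x => is_true (g %| x)) s -> g != 0.
Proof.
move=> [_ _ s_full]; apply/negP => /eqP g0.
pose k := (\sum_(x <- s) size x)%N.
have [y ys] := s_full 'X^k Logic.I.
rewrite /qcong g0 dvd0p subr_eq0 => /eqP def_y.
have : (size y <= k)%N.
  by rewrite /k (big_rem y ys) /= leq_addr.
by rewrite -def_y size_polyXn ltnn.
Qed.

Lemma ltn_size_mul f g : (1 < size f)%N -> g != 0 ->
  (size g < size (f * g)%R)%N.
Proof.
move=> f_gt1 g0; have f0 : f != 0 by rewrite -size_poly_gt0 ltnW.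
rewrite size_mul //; case: (size f) f_gt1 => [|[|m]] // _.
by rewrite addSn /= addSn ltnS leq_addl.
Qed.

(** If g = h p^2, then g divides (h p)^2, hence (h p)^N, hence h p, forcing p to be a unit. *)
Lemma power_fixed_squarefree g p N : (1 < N)%N -> g != 0 ->
  irreducible_poly p -> (forall a, g %| a ^+ N - a) -> ~~ (p ^+ 2 %| g).
Proof.
move=> N_gt1 g0 irr_p powN; apply/negP => /dvdpP[h def_g].
have p0 := irredp_neq0 irr_p.
have h0 : h != 0 by apply: contraNneq g0 => h0; rewrite def_g h0 mul0r.
have g_pow : g %| (h * p) ^+ N.
  rewrite -(subnK N_gt1) exprD dvdp_mull // def_g exprMn.
  by rewrite dvdp_mul // expr2 dvdp_mulr.
have : g %| h * p by rewrite -(dvdp_subr _ g_pow) powN.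
rewrite def_g expr2 mulrA -{2}[h * p]mulr1 dvdp_mul2l ?mulf_neq0 //.
by rewrite dvdp1 => /eqP p1; have := irr_p.1; rewrite p1.
Qed.

End PolynomialResidues.

(** * From irreducible factors to their product *)

Section GlobalResidues.

Variables (Fq : finFieldType) (L : splittingFieldType {fraction {poly Fq}}).
Hypothesis galL : galois 1%VS {:L}.
Local Notation n := (\dim {:L}).
Local Notation I f := (principalOK (polyK L f)).
Implicit Types (f g h p : {poly Fq}).

Lemma principalOK_unit f x : size f = 1%N -> OK x -> I f x.
Proof.
move=> f1 Ox; rewrite -[x]mul1r -(rmorph1 (polyK L)).
by apply: principalOKMr => //; apply: principalOK_dvdp; rewrite dvdp1 f1.
Qed.

(** Irreducible factors are split off one at a time; squarefreeness makes each coprime to its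
    cofactor, so the memberships combine. *)
Lemma principalOK_squarefree f x : f != 0 -> OK x ->
    (forall p, irreducible_poly p -> p %| f -> ~~ (p ^+ 2 %| f) /\ I p x) ->
  I f x.
Proof.
have [k] := ubnP (size f); elim: k f => // k IHk f lt_fk f0 Ox pf.
have [f_gt1 | f_le1] := ltnP 1 (size f); last first.
  apply: principalOK_unit => //.
  by apply/eqP; rewrite eqn_leq f_le1 size_poly_gt0.
have [p irr_p p_f] := irreducible_factor f_gt1.
have [p2_f px] := pf p irr_p p_f.
have p0 := irredp_neq0 irr_p.
move: p_f => /dvdpP[h def_f]; rewrite mulrC in def_f.
have h0 : h != 0 by apply: contraNneq f0 => h0; rewrite def_f h0 mulr0.
rewrite def_f; apply: principalOK_coprime_mul => //.
  rewrite irreducible_poly_coprime //; apply: contra p2_f => p_h.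
  by rewrite def_f expr2 dvdp_mul2l.
apply: IHk => // [|q irr_q q_h].
  by rewrite -ltnS (leq_trans _ lt_fk) // ltnS def_f ltn_size_mul // irr_p.1.
have q_f : q %| f by rewrite def_f dvdp_mull.
have [q2_f qx] := pf q irr_q q_f; split=> //.
by apply: contra q2_f => q2_h; rewrite def_f dvdp_mull.
Qed.

(** An expansion in base f: the first digit is determined modulo f, the second modulo h after
    division by f. *)
Lemma residue_system_mul f h (T U : finType) (E1 : T -> L) (E2 : U -> L) :
  f != 0 -> residue_system (@OK _ L) (I f) E1 ->
  residue_system (@OK _ L) (I h) E2 ->
  residue_system (@OK _ L) (I (f * h))
    (fun tu : T * U => E1 tu.1 + polyK L f * E2 tu.2).
Proof.
move=> f0 [OE1 E1_inj E1_full] [OE2 E2_inj E2_full].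
have fL0 : polyK L f != 0 by rewrite polyK_eq0.
split=> [tu | [t u] [t' u'] /= | z Oz].
- by apply: OKD (OE1 _) _; apply: OKM (OK_polyK _ _) (OE2 _).
- rewrite opprD addrACA -mulrBr => -[z Oz eq_z].
  have OE2B : OK (E2 u - E2 u') by apply: OKB (OE2 u) (OE2 u').
  have tt' : t = t'.
    apply: E1_inj; exists (polyK L h * z - (E2 u - E2 u')).
      by apply: OKB => //; apply: OKM => //; apply: OK_polyK.
    by rewrite mulrBr mulrA -rmorphM -eq_z addrK.
  congr (_, _) => //; apply: E2_inj; exists z => //.
  by apply: (mulfI fL0); rewrite mulrA -rmorphM -eq_z tt' subrr add0r.
- have [t [y Oy def_y]] := E1_full z Oz; have [u [v Ov def_v]] := E2_full y Oy.
  exists (t, u); exists v => //=.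
  by rewrite opprD addrA def_y -mulrBr def_v rmorphM mulrA.
Qed.

Lemma residue_system_unit f : size f = 1%N ->
  residue_system (@OK _ L) (I f) (fun _ : 'I_1 => 0).
Proof.
move=> f1; split=> [_ | x y _ | z Oz]; first exact: OK0.
  by rewrite !ord1.
by exists ord0; rewrite subr0; apply: principalOK_unit.
Qed.

(** Each irreducible factor p of f, counted with multiplicity, contributes q^(n deg p), and the
    degrees add up to deg f. *)
Lemma exists_residue_system f : f != 0 -> disc_coprime L f ->
  exists (T : finType) (E : T -> L),
    residue_system (@OK _ L) (I f) E /\ #|T| = (#|Fq| ^ (n * (size f).-1))%N.
Proof.
have [k] := ubnP (size f); elim: k f => // k IHk f lt_fk f0 disc_f.
have [f_gt1 | f_le1] := ltnP 1 (size f); last first.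
  have f1 : size f = 1%N by apply/eqP; rewrite eqn_leq f_le1 size_poly_gt0.
  exists 'I_1, (fun=> 0); split; first exact: residue_system_unit.
  by rewrite card_ord f1 muln0.
have [p irr_p p_f] := irreducible_factor f_gt1.
have [b [D [Ob D0 discD cop_pD]]] :=
  unramified_basis galL irr_p (disc_f p irr_p p_f).
have p0 := irredp_neq0 irr_p; have p_gt1 := irr_p.1.
have [E1 rsE1] := residue_system_unramified Ob D0 discD cop_pD p0.
move: p_f => /dvdpP[h def_f]; rewrite mulrC in def_f.
have h0 : h != 0 by apply: contraNneq f0 => h0; rewrite def_f h0 mulr0.
have size_f : (size f).-1 = ((size p).-1 + (size h).-1)%N.
  rewrite def_f size_mul // -[size h]prednK ?size_poly_gt0 // addnS /=.
  by rewrite -[in LHS](prednK (ltnW p_gt1)).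
have [||T [E [rsE cardT]]] := IHk h _ h0.
- by rewrite -ltnS (leq_trans _ lt_fk) // ltnS def_f ltn_size_mul.
- by move=> q irr_q q_h; apply: disc_f => //; rewrite def_f dvdp_mull.
exists ('M[Fq]_(n, (size p).-1) * T)%type,
  (fun mt => E1 mt.1 + polyK L p * E mt.2).
split; first by rewrite def_f; apply: residue_system_mul.
by rewrite card_prod card_mx cardT -expnD -mulnDr size_f.
Qed.

Lemma pchar_natX_card k : [pchar L].-nat (#|Fq| ^ k)%N.
Proof.
have [l l_prime l_char] := finPcharP Fq.
have l_charL : l \in [pchar L].
  by rewrite (fmorph_pchar (polyK L \o polyC)).
apply: sub_in_pnat (_ : l.-nat _) => [m _ /eqP -> //|].
by rewrite pnatX (card_pprimeChar l_char) pnatX pnat_id.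
Qed.

End GlobalResidues.

(** * Transfer of the Carmichael property from F_q[t]/(g) to O_K/(g) *)

Theorem theorem5p1 (Fq : finFieldType) (g : {poly Fq})
  (L : splittingFieldType {fraction {poly Fq}}) :
  Carmichael_poly g ->
  galois 1%VS {:L} ->
  disc_coprime L g ->
  Carmichael_in (polyK L g).
Proof.
move=> [s [reps_s nfield pow_s]] galL disc_g.
have g0 := qreps_poly_neq0 reps_s.
have sizeN := size_qreps_poly g0 reps_s.
have powN a : g %| a ^+ size s - a by apply: pow_s.
have [T [E [rsE cardT]]] := exists_residue_system galL g0 disc_g.
have N_gt1 : (1 < size g)%N -> (1 < size s)%N.
  move=> g_gt1; rewrite sizeN -{1}(expn0 #|Fq|) ltn_exp2l;
    last exact: card_finNzRing_gt1.
  by rewrite -ltnS prednK // ltnW.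
split; first exact: OK_polyK.
exists [seq E x | x <- enum T]; split; first exact: qreps_residue_system.
  move=> [n10 inv_g]; apply: nfield.
  have ng1 : ~ qcong (fun x => is_true (g %| x)) 1 0.
    rewrite /qcong subr0 => g1; apply: n10; rewrite /qcong subr0.
    by rewrite -(rmorph1 (polyK L)); apply: principalOK_dvdp.
  split=> // x _; rewrite /qcong subr0 => ng_x.
  have [|y Oy xy1] := inv_g (polyK L x) (OK_polyK L x).
    by rewrite /qcong subr0 => gx; apply: ng_x; apply: principalOK_polyK gx.
  (* With N = [size s], a nonzero x in a field with x^N = x satisfies x^(N-1) = 1, so x^(N-2) is its
     inverse, and this is again a polynomial. *)
  exists (x ^+ (size s).-2) => //.
  have g_gt1 : (1 < size g)%N.
    rewrite ltn_neqAle size_poly_gt0 g0 andbT; apply/negP => /eqP g1.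
    by apply: ng1; rewrite /qcong subr0 dvdp1 -g1.
  apply: (principalOK_polyK (L := L) g0); rewrite -exprS.
  have sE : size s = (size s).-2.+2 by rewrite -subn2 -addn2 subnK ?N_gt1.
  set z := x ^+ _ - 1.
  (* Here y inverts x modulo g, and x z = x^N - x vanishes there, so z does too. *)
  have -> : polyK L z = y * polyK L (x ^+ size s - x) -
      (polyK L x * y - 1) * polyK L z.
    have -> : x ^+ size s - x = x * z by rewrite sE exprS mulrBr mulr1.
    rewrite rmorphM mulrBl mul1r mulrA [y * _]mulrC.
    by rewrite opprB addrCA subrr addr0.
  apply: principalOKB; last exact: principalOKMr (OK_polyK _ _).
  by apply: principalOKMl => //; apply: principalOK_dvdp.
(* The number of representatives is q^(n deg g) = N^n, the exponent of the iterated power map modulo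
   each p. *)
move=> w Ow; rewrite size_map -cardE cardT mulnC expnM -sizeN /qcong.
apply: principalOK_squarefree => // [|p irr_p p_g].
  by apply: OKB => //; apply: OKX.
have g_gt1 : (1 < size g)%N := leq_trans irr_p.1 (dvdp_leq g0 p_g).
split; first exact: power_fixed_squarefree (N_gt1 g_gt1) g0 irr_p powN.
have [b [D [Ob D0 discD cop_pD]]] :=
  unramified_basis galL irr_p (disc_g p irr_p p_g).
apply: frobenius_iter_mod Ob D0 discD cop_pD _ _ _ _ Ow.
  by rewrite sizeN pchar_natX_card.
by move=> a; apply: dvdp_trans p_g (powN a).
Qed.
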